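(* Let $1<p_1,p_2<\infty$ and let $0<q<\infty$. Let $\mathbb{X}$ be a metric measure space with a polar decomposition at $a\in\mathbb{X}$. Let $u,v_1,v_2>0$ be measurable functions, positive a.e. in $\mathbb{X}$, such that $u\in L^1_{loc}(\mathbb{X}\setminus\{a\})$ and $v_i^{1-p_i'}\in L^1_{loc}(\mathbb{X})$ for $i=1,2$. Let $$H_2^B(f_1,f_2)(x):=\int_{B(a,|x|_a)}f_1(y)\,dy\;\int_{B(a,|x|_a)}f_2(y)\,dy .$$ Then the inequality $$\left(\int_{\mathbb{X}}\left(H_2^B(f_1,f_2)(x)\right)^q u(x)\,dx\right)^{1/q}\le C\left(\int_{\mathbb{X}}f_1(x)^{p_1}v_1(x)\,dx\right)^{1/p_1}\left(\int_{\mathbb{X}}f_2(x)^{p_2}v_2(x)\,dx\right)^{1/p_2}$$ holds for all measurable $f_1,f_2\ge 0$ on $\mathbb{X}$ if and only if the inequality $$\left(\int_0^\infty\left(H_2(F_1,F_2)(\tau)\right)^q\widetilde{U}(\tau)\,d\tau\right)^{1/q}\le C\left(\int_0^\infty F_1^{p_1}(\tau)\widetilde{V}_1(\tau)\,d\tau\right)^{1/p_1}\left(\int_0^\infty F_2^{p_2}(\tau)\widetilde{V}_2(\tau)\,d\tau\right)^{1/p_2}$$ holds for all measurable $F_1,F_2\ge 0$ on $(0,\infty)$, where $\widetilde{U},\widetilde{V}_1,\widetilde{V}_2$ are the weight functions $$\widetilde{U}(\tau):=\int_{\Sigma_\tau}u(\tau,\omega)\,\lambda(\tau,\omega)\,d\omega_\tau,\qquad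 \widetilde{V}_i(\tau):=\left(\int_{\Sigma_\tau}v_i^{1-p_i'}(\tau,\omega)\,\lambda(\tau,\omega)\,d\omega_\tau\right)^{1-p_i},\quad i=1,2 .$$ Moreover, the constants $C$ in the two inequalities are the same.
   Context: A metric measure space with a polar decomposition at a fixed point $a\in\mathbb{X}$ is a metric space $(\mathbb{X},d)$ with a Borel measure $dx$ such that there is a function $\lambda\in L^1_{loc}$ with $$\int_{\mathbb{X}}g(x)\,dx=\int_0^\infty\int_{\Sigma_r}g(r,\omega)\,\lambda(r,\omega)\,d\omega_r\,dr$$ for all $g\in L^1(\mathbb{X})$, where $\Sigma_r=\{x\in\mathbb{X}:d(x,a)=r\}$ is equipped with a measure denoted $d\omega_r$ (also written $d\omega$), a point $x\in\Sigma_r$ is written $x=(r,\omega)$, and $(r,\omega)\to a$ as $r\to 0$. The function $\lambda$ may depend on the whole variable $x=(r,\omega)$. No doubling condition is assumed on the measure. Notation: $|x|_a:=d(a,x)$; $B(a,r):=\{x\in\mathbb{X}:d(x,a)<r\}$; $p'$ is the conjugate exponent, $\frac1p+\frac1{p'}=1$; for $F_1,F_2\ge0$ on $(0,\infty)$, $$H_2(F_1,F_2)(y):=\left(\int_0^yF_1(x)\,dx\right)\left(\int_0^yF_2(x)\,dx\right).$$ *)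

(* Defs.v *)
From HB Require Import structures.
From mathcomp Require Import all_boot all_order all_algebra.
From mathcomp Require Import all_classical all_reals all_analysis.
From mathcomp Require Import measurable_realfun.

Set Implicit Arguments.
Unset Strict Implicit.
Unset Printing Implicit Defensive.

Import Order.TTheory GRing.Theory Num.Theory.
Import numFieldNormedType.Exports.

Local Open Scope classical_set_scope.
Local Open Scope ring_scope.

HB.mixin Record Metric_isBorel (d : measure_display) (R : realType) T
    & Metric R T & Measurable d T := {
  borel_measurableE : @measurable d T = <<s @open T >>
}.

#[short(type="borelMetricType")]
HB.structure Definition BorelMetric (d : measure_display) (R : realType) :=
  { T of Metric R T & Measurable d T & Metric_isBorel d R T }.

Section PolarDecomposition.
Context {d : measure_display} {R : realType} {X : borelMetricType d R}.
Local Open Scope ereal_scope.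

Implicit Types (mu : {measure set X -> \bar R}) (a : X) (lam : X -> R)
  (omega : R -> {measure set X -> \bar R}).

Definition sphere a (r : R) : set X := [set x | mdist a x = r].

(* [f] belongs to L^1_loc(D), in the sense usual for metric measure spaces:
   [f] is integrable on every bounded measurable set lying at positive distance
   from the complement of [D].  When closed balls are compact, these are the
   measurable subsets of the compact subsets of the open set [D]; in a general
   metric space compact sets are too scarce to define L^1_loc. *)
Definition L1loc mu (D : set X) (f : X -> R) : Prop :=
  measurable_fun D f /\
  forall E : set X, measurable E ->
    (exists (x : X) (r : R), E `<=` ball x r) ->
    (exists2 e : R, (0 < e)%R & forall x, E x -> ball x e `<=` D) ->
    mu.-integrable E (EFin \o f).

(* The measure on the sphere of radius [r] is given as a Borel measure
   [omega r] on the whole space, of which only the restriction to the sphere is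
   ever used. *)
Definition polar_integral a lam omega (g : X -> R) (r : R) : \bar R :=
  \int[omega r]_(x in sphere a r) (g x * lam x)%:E.

(* The density [lam] is locally integrable with respect to [domega_r dr] on
   0 < r < +oo.  The requirement that (r, omega) tend to [a] as r tends to 0
   holds by definition of [sphere]. *)
Definition polar_decomposition mu a lam omega : Prop :=
  [/\ measurable_fun [set: X] lam,
      forall s t : R, (0 < s)%R -> (s < t)%R ->
        \int[lebesgue_measure]_(r in `]s, t[)
          \int[omega r]_(x in sphere a r) `|lam x|%:E < +oo
    & forall g : X -> R, mu.-integrable [set: X] (EFin \o g) ->
        measurable_fun `](0 : R)%R, +oo[ (polar_integral a lam omega g) /\
        \int[mu]_x (g x)%:E =
        \int[lebesgue_measure]_(r in `](0 : R)%R, +oo[) polar_integral a lam omega g r].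

Definition H2B mu a (f1 f2 : X -> R) (x : X) : \bar R :=
  (\int[mu]_(y in ball a (mdist a x)) (f1 y)%:E) *
  (\int[mu]_(y in ball a (mdist a x)) (f2 y)%:E).

Definition conj_exponent (p : R) : R := fine (hoelder_conjugate p%:E).

Definition Utilde a lam omega (u : X -> R) (t : R) : \bar R :=
  polar_integral a lam omega u t.

(* The power 1 - p < 0 is written as the inverse of the power p - 1 > 0, so that
   0 ^ (1 - p) = +oo and (+oo) ^ (1 - p) = 0; the library's [poweR] at a negative
   exponent sends 0 to 0 and +oo to +oo. *)
Definition Vtilde a lam omega (p : R) (v : X -> R) (t : R) : \bar R :=
  (polar_integral a lam omega (fun x => v x `^ (1 - conj_exponent p))%R t
     `^ (p - 1))^-1.

End PolarDecomposition.

Definition H2 {R : realType} (F1 F2 : R -> R) (y : R) : \bar R :=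
  ((\int[lebesgue_measure]_(x in `](0 : R)%R, y[) (F1 x)%:E) *
   (\int[lebesgue_measure]_(x in `](0 : R)%R, y[) (F2 x)%:E))%E.

(* Main.v *)
Require Import Defs.
From HB Require Import structures.
From mathcomp Require Import all_boot all_order all_algebra.
From mathcomp Require Import all_classical all_reals all_analysis.
From mathcomp Require Import measurable_realfun.
From mathcomp Require Import ring.

Set Implicit Arguments.
Unset Strict Implicit.
Unset Printing Implicit Defensive.

Import Order.TTheory GRing.Theory Num.Theory.
Import numFieldNormedType.Exports.

Local Open Scope classical_set_scope.
Local Open Scope ring_scope.

(** Write [P f r] for the integral of [f] over the sphere of radius [r] with
    respect to [lam domega_r].  The theorem holds because both inequalities see
    [f1], [f2] only through [P f1], [P f2].

    - Since a ball around [a] is a union of spheres, the integral of [f] over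
      [ball a s] is the integral of [P f] over [(0, s)].  Hence [H2B f1 f2] is a
      function of the distance to [a], namely [H2 (P f1) (P f2)], and integrating
      its power against [u] over the spheres produces [Utilde]: the left-hand
      sides agree when [F1 = P f1] and [F2 = P f2] ([integral_H2B]).
    - Put [W = P (v^(1-p'))].  Hoelder's inequality on each sphere gives
      [(P f)^p W^(1-p) <= P (f^p v)], so passing from [f] to [F = P f] does not
      increase the weighted norm ([spherical_integral_bound]).
    - Conversely [f = F(|x|) v^(1-p') / W(|x|)] satisfies [P f = F] and has the
      same weighted norm as [F] ([spherical_spread]).

    Each inequality thus implies the other with the same constant.  If one of the
    two norms is infinite the bound is trivial unless the other norm is zero, and
    then that function vanishes almost everywhere, and so does the left-hand side
    ([norm_product_bound]).

    The polar decomposition is only given for integrable functions, and [lam] is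
    not assumed nonnegative.  Local integrability and positivity of
    [v1^(1-p1')] make [mu] sigma-finite; for almost every [r] the density [lam] is
    then nonnegative [omega r]-almost everywhere on the sphere, so that
    [lam domega_r] is a measure [kappa r], and the decomposition extends to
    all nonnegative measurable functions ([polar_disintegration]).  On the
    exceptional null set of radii the weights [Utilde] and [Vtilde] can be
    non-measurable or negative, which is why integrals are compared by lemmas that
    assume no measurability ([ae_le_integral], [ae_ge0_eq_integral]). *)

(** * Comparison of integrals without measurability *)

Section ae_le_integral.
Context {d : measure_display} {T : measurableType d} {R : realType}.
Variable mu : {measure set T -> \bar R}.
Local Open Scope ereal_scope.
Import HBNNSimple.
Implicit Types (D : set T) (f g : T -> \bar R).

Let ae_le_integral0 D f g : (forall x, D x -> 0 <= f x) ->
  (forall x, D x -> 0 <= g x) -> (\forall x \ae mu, D x -> f x <= g x) ->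
  \int[mu]_(x in D) f x <= \int[mu]_(x in D) g x.
Proof.
move=> f0 g0 [N [mN N0 fgN]]; rewrite !ge0_integralE//=.
apply: ge_ereal_sup => _ [h/= hf <-].
pose h' := proj_nnsfun h (measurableC mN).
apply: le_ereal_sup_tmp; exists (sintegral mu h').
- exists h' => //= x; rewrite mindicE in_setC.
  have [xN|xN] := boolP (x \in N).
    rewrite /= mulr0; exact: erestrict_ge0.
  rewrite /= mulr1; apply: (le_trans (hf x)); rewrite !patchE.
  case: ifPn => // xD; apply: contrapT => fg.
  move/negP: xN; apply; rewrite inE; apply: fgN => /= /(_ (set_mem xD)).
  exact: fg.
- rewrite -!integralT_nnsfun le_eqVlt; apply/orP; left; apply/eqP.
  apply: ge0_ae_eq_integral => //.
  + exact/measurable_EFinP.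
  + exact/measurable_EFinP.
  + by move=> x _; rewrite lee_fin.
  + by move=> x _; rewrite lee_fin.
  exists N; split => // x /= /not_implyP[_ hh]; apply: contrapT => xN; apply: hh.
  by rewrite /h'/= mindicE in_setC memNset// mulr1.
Qed.

(** The integral of a nonnegative function is a supremum over simple functions
    below it, and each of them may be cut off on a null set; hence neither [f] nor
    [g] has to be measurable. *)
Lemma ae_le_integral D f g :
  (\forall x \ae mu, D x -> 0 <= f x) -> (\forall x \ae mu, D x -> f x <= g x) ->
  \int[mu]_(x in D) f x <= \int[mu]_(x in D) g x.
Proof.
move=> f0 fg; rewrite [leLHS]integralE [leRHS]integralE.
have -> : \int[mu]_(x in D) g^\- x = 0.
  apply/eqP; rewrite eq_le integral_ge0// andbT -(integral0 mu D).
  apply: ae_le_integral0 => //; apply: filterS2 f0 fg => x f0 fg Dx.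
  by rewrite funenegE ge_max lexx andbT leeNl oppe0 (le_trans (f0 Dx))// fg.
rewrite sube0 (@le_trans _ _ (\int[mu]_(x in D) f^\+ x))//.
  by rewrite -[leRHS]sube0 leeB// integral_ge0.
apply: ae_le_integral0 => //; apply: filterS fg => x fg Dx.
by rewrite !funeposE ge_max !le_max lexx orbT fg.
Qed.

Lemma ae_ge0_eq_integral D f g :
  (\forall x \ae mu, D x -> 0 <= g x) -> (\forall x \ae mu, D x -> f x = g x) ->
  \int[mu]_(x in D) f x = \int[mu]_(x in D) g x.
Proof.
move=> g0 fg; apply/eqP; rewrite eq_le; apply/andP; split; apply: ae_le_integral.
- by apply: filterS2 g0 fg => x + + Dx => /(_ Dx) ? /(_ Dx) ->.
- by apply: filterS fg => x + Dx => /(_ Dx) ->.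
- exact: g0.
- by apply: filterS fg => x + Dx => /(_ Dx) ->.
Qed.

Lemma integral_eq0_ae0 f : measurable_fun setT f -> (forall x, 0 <= f x) ->
  \int[mu]_x f x = 0 -> \forall x \ae mu, f x = 0.
Proof.
move=> mf f0 If; have /(ae_eq_integral_abs mu measurableT mf) : 
    \int[mu]_x `|f x| = 0.
  by rewrite -[RHS]If; apply: eq_integral => x _; rewrite gee0_abs.
by apply: filterS => x; apply.
Qed.

Lemma integral_lty_ae D f : measurable D -> measurable_fun D f ->
  (forall x, 0 <= f x) ->
  \int[mu]_(x in D) f x < +oo -> \forall x \ae mu, D x -> f x < +oo.
Proof.
move=> mD mf f0 If; have /(integrable_ae mD) : mu.-integrable D f.
  apply/integrableP; split=> //; apply: le_lt_trans If.
  by apply: ae_le_integral; apply: aeW => x _ //; rewrite gee0_abs.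
by apply: filterS => x /[apply]; rewrite ge0_fin_numE.
Qed.

End ae_le_integral.

(** * Measures with a density *)

Section density.
Context {d : measure_display} {T : measurableType d} {R : realType}.
Variables (nu : {measure set T -> \bar R}) (h : T -> R).
Local Open Scope ereal_scope.

(** The measure with density [h] with respect to [nu]; the hypotheses that make
    it a measure are arguments of the definition so that an instance of the
    measure structure can be attached to it. *)
Definition density (mh : measurable_fun [set: T] h) (h0 : forall x, (0 <= h x)%R)
  (A : set T) : \bar R := \int[nu]_(x in A) (h x)%:E.

Variables (mh : measurable_fun [set: T] h) (h0 : forall x, (0 <= h x)%R).

Let density_set0 : density mh h0 set0 = 0.
Proof. exact: integral_set0. Qed.

Let density_ge0 A : 0 <= density mh h0 A.
Proof. by apply: integral_ge0 => x _; rewrite lee_fin. Qed.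

Let density_sigma_additive : semi_sigma_additive (density mh h0).
Proof.
move=> /= F mF tF mUF; rewrite /density; apply: cvg_toP.
  apply: ereal_nondecreasing_is_cvgn => m n mn.
  apply: lee_sum_nneg_natr => // k _ _.
  by apply: integral_ge0 => /= x _; rewrite lee_fin.
rewrite ge0_integral_bigcup//=.
- by apply: measurable_funTS; exact/measurable_EFinP.
- by move=> x _; rewrite lee_fin.
Qed.

HB.instance Definition _ := isMeasure.Build _ _ _ (density mh h0)
  density_set0 density_ge0 density_sigma_additive.

Import HBNNSimple.

Let integral_density_indic E : measurable E ->
  \int[density mh h0]_x (\1_E x)%:E = \int[nu]_x ((\1_E x)%:E * (h x)%:E).
Proof.
move=> mE; rewrite integral_indic// setIT /= /density integral_mkcond.
by apply: eq_integral => x _; rewrite epatch_indic muleC.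
Qed.

Let integral_density_nnsfun (f : {nnsfun T >-> R}) :
  \int[density mh h0]_x (f x)%:E = \int[nu]_x ((f x)%:E * (h x)%:E).
Proof.
have mEh : measurable_fun [set: T] (EFin \o h) by exact/measurable_EFinP.
under [LHS]eq_integral do rewrite fimfunE -fsumEFin//.
rewrite [LHS]ge0_integral_fsum//; last 2 first.
- by move=> r; exact/measurable_EFinP/measurableT_comp.
- by move=> n x _; rewrite EFinM nnfun_muleindic_ge0.
under [RHS]eq_integral.
  move=> x xD; rewrite fimfunE -fsumEFin// muleC ge0_mule_fsumr; last first.
    by move=> r; rewrite EFinM nnfun_muleindic_ge0.
  over.
rewrite [RHS]ge0_integral_fsum//; last 2 first.
- move=> r; apply: emeasurable_funM => //.
  by apply/measurable_EFinP; apply/measurableT_comp.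
- move=> n x _; rewrite EFinM mule_ge0//; last by rewrite nnfun_muleindic_ge0.
  by rewrite lee_fin.
apply: eq_fsbigr => r _; rewrite integralZl_indic_nnsfun//.
rewrite integral_density_indic//.
have [r0|r0] := leP 0%R r.
  rewrite -ge0_integralZl//.
  - by apply: eq_integral => x _; rewrite EFinM [RHS]muleC -muleA.
  - by apply: emeasurable_funM => //; exact/measurable_EFinP.
  - by move=> x _; rewrite mule_ge0// lee_fin.
rewrite preimage_nnfun0// [X in _ * X]integral0_eq ?mule0//; last first.
  by move=> x _; rewrite indicE in_set0 mul0e.
by rewrite integral0_eq// => x _; rewrite indicE in_set0 mulr0 mule0.
Qed.

Lemma ge0_integral_density (f : T -> \bar R) : measurable_fun [set: T] f ->
  (forall x, 0 <= f x) ->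
  \int[density mh h0]_x f x = \int[nu]_x (f x * (h x)%:E).
Proof.
move=> mf f0; have mEh : measurable_fun [set: T] (EFin \o h).
  exact/measurable_EFinP.
pose f_ := nnsfun_approx measurableT mf.
have nd x m n : (m <= n)%N -> ((f_ m x)%:E <= (f_ n x)%:E).
  by move=> mn; rewrite lee_fin; exact/lefP/nd_nnsfun_approx.
transitivity (limn (fun n => \int[density mh h0]_x (f_ n x)%:E)).
  rewrite -monotone_convergence//=.
  - apply: eq_integral => ? /[!inE] xD; apply/esym/cvg_lim => //=.
    exact: cvg_nnsfun_approx.
  - by move=> n; exact/measurable_EFinP/measurable_funTS.
  - by move=> n ? _; rewrite lee_fin.
  - by move=> x _ m n; exact: nd.
under eq_fun do rewrite integral_density_nnsfun.
rewrite -monotone_convergence//=.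
- apply: eq_integral => x _; apply/cvg_lim => //; apply: cvgeZr => //.
  exact: cvg_nnsfun_approx.
- by move=> n; apply: emeasurable_funM => //; exact/measurable_EFinP.
- by move=> n ? _; rewrite mule_ge0// lee_fin.
- by move=> x _ m n mn; rewrite lee_wpmul2r ?lee_fin//; exact: nd.
Qed.

Lemma integral_density (f : T -> \bar R) : measurable_fun [set: T] f ->
  \int[density mh h0]_x f x = \int[nu]_x (f x * (h x)%:E).
Proof.
move=> mf; rewrite [LHS]integralE [RHS]integralE !ge0_integral_density//.
congr (_ - _); apply: eq_integral => x _.
  by rewrite !funeposE maxe_pMl ?lee_fin// mul0e.
  by rewrite !funenegE maxe_pMl ?lee_fin// mul0e mulNe.
exact: measurable_funeneg.
exact: measurable_funepos.
Qed.

End density.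

(** * Approximation by integrable functions *)

Section sigma_finite_approximation.
Context {d : measure_display} {T : measurableType d} {R : realType}.
Variable mu : {measure set T -> \bar R}.
Local Open Scope ereal_scope.
Import HBNNSimple.

(** Truncating the usual simple approximations to sets of finite measure. *)
Lemma sigma_finite_integrable_approx (g : T -> \bar R) :
  sigma_finite [set: T] mu -> measurable_fun [set: T] g ->
  (forall x, 0 <= g x) ->
  exists g_ : nat -> T -> R,
    [/\ forall n, mu.-integrable [set: T] (EFin \o g_ n),
        forall n x, (0 <= g_ n x)%R,
        forall x m n, (m <= n)%N -> (g_ m x <= g_ n x)%R &
        forall x, (g_ n x)%:E @[n --> \oo] --> g x].
Proof.
move=> /sigma_finiteP[F [FT ndF mF]] mg g0.
pose h := nnsfun_approx measurableT mg.
exists (fun n x => h n x * \1_(F n) x)%R; split.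
- move=> n; have [M [_ /= hM]] := simple_bounded (h n).
  have {}hM x : (h n x <= `|M| + 1)%R.
    rewrite (le_trans (ler_norm _))// hM//.
    by rewrite (le_lt_trans (ler_norm M))// ltrDl.
  apply/integrableP; split.
    apply/measurable_EFinP; apply: measurable_funM => //.
    exact/measurable_indic/(mF n).1.
  have -> : \int[mu]_x `|(EFin \o (fun x => h n x * \1_(F n) x)%R) x| =
      \int[mu]_(x in F n) (h n x)%:E.
    rewrite [RHS]integral_mkcond; apply: eq_integral => x _ /=.
    rewrite patchE indicE; case: (x \in F n).
      by rewrite mulr1 ger0_norm.
    by rewrite mulr0 normr0.
  apply: (@le_lt_trans _ _ (\int[mu]_(x in F n) (`|M| + 1)%:E)).
    by apply: ae_le_integral; apply: aeW => x _; rewrite lee_fin.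
  rewrite integral_cst//; last exact: (mF n).1.
  by rewrite lte_mul_pinfty// ?lee_fin ?addr_ge0// (mF n).2.
- by move=> n x; rewrite mulr_ge0.
- move=> x m n mn; rewrite ler_pM//; first exact/lefP/nd_nnsfun_approx.
  rewrite !indicE ler_nat; have [xF|//] := boolP (x \in F m).
  by rewrite mem_set//; have /subsetPset := ndF _ _ mn; apply; exact: set_mem.
- move=> x; have [N _ FNx] : (\bigcup_i F i) x by rewrite -FT.
  apply: cvg_trans (cvg_nnsfun_approx measurableT mg (fun x _ => g0 x) I).
  apply: near_eq_cvg; near=> n => /=; rewrite indicE mem_set ?mulr1//.
  have /ndF/subsetPset : (N <= n)%N by near: n; exact: nbhs_infty_ge.
  exact.
Unshelve. all: by end_near. Qed.

End sigma_finite_approximation.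

(** * Measurability of the distance function *)

Section metric_measurability.
Context {d : measure_display} {R : realType} {X : borelMetricType d R}.
Implicit Type a : X.

Lemma open_metric_ball a r : open (ball a r).
Proof.
rewrite openE => x; rewrite ballEmdist /= => axr.
apply/nbhs_ballP; exists (r - mdist a x) => /=; first by rewrite subr_gt0.
move=> y; rewrite !ballEmdist /= ltrBrDl => xy.
exact: le_lt_trans (metric_triangle _ _ _) xy.
Qed.

Lemma measurable_metric_ball a r : measurable (ball a r).
Proof.
rewrite borel_measurableE; apply: sub_sigma_algebra; exact: open_metric_ball.
Qed.

Lemma measurable_mdist a : measurable_fun [set: X] (mdist a : X -> R).
Proof.
apply: (measurability _ (RGenInftyO.measurableE R)) => _ [_ [r ->] <-].
rewrite setTI (_ : _ @^-1` _ = ball a r); first exact: measurable_metric_ball.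
by rewrite ballEmdist; apply/seteqP; split => x /=; rewrite in_itv.
Qed.

Lemma measurable_sphere a r : measurable (sphere a r).
Proof.
rewrite -[sphere a r]setTI.
exact: (measurable_mdist a measurableT (measurable_set1 r)).
Qed.

End metric_measurability.

(** * Disintegration of the measure along the distance *)

Section disintegration.
Context {d : measure_display} {R : realType} {X : borelMetricType d R}.
Implicit Types (mu : {measure set X -> \bar R}) (a : X) (lam : X -> R)
  (omega kappa : R -> {measure set X -> \bar R}).
Local Open Scope ereal_scope.
Local Notation leb := (@lebesgue_measure R).

(** [kappa] disintegrates [mu] along the distance to [a]: [kappa r] lives on the
    sphere of radius [r], vanishes for [r <= 0], and integrating first against
    [kappa r] and then in [r] gives back [mu], for all nonnegative measurable
    functions, infinite values allowed. *)
Definition disintegrates mu a kappa : Prop :=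
  [/\ forall g : X -> \bar R, measurable_fun [set: X] g -> (forall x, 0 <= g x) ->
        measurable_fun [set: R] (fun r => \int[kappa r]_x g x),
      forall g : X -> \bar R, measurable_fun [set: X] g -> (forall x, 0 <= g x) ->
        \int[mu]_x g x = \int[leb]_r \int[kappa r]_x g x,
      forall r, kappa r (~` sphere a r) = 0 &
      forall r, (r <= 0)%R -> kappa r [set: X] = 0].

(** For almost every radius [r], the measure [kappa r] is [lam domega_r]
    restricted to the sphere of radius [r]. *)
Lemma polar_disintegration mu a lam omega :
  polar_decomposition mu a lam omega -> sigma_finite [set: X] mu ->
  exists kappa, disintegrates mu a kappa /\
    {ae leb, forall r, (0 < r)%R -> forall g : X -> R,
      measurable_fun [set: X] g ->
      polar_integral a lam omega g r = \int[kappa r]_x (g x)%:E}.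
Proof.
move=> [mlam _ polarE] sfmu; have [F [FT _ mF]] := (sigma_finiteP _ _).1 sfmu.
pose A n := F n `&` [set x | (lam x < 0)%R].
have mA n : measurable (A n).
  apply: measurableI; first exact: (mF n).1.
  rewrite -[X in measurable X]setTI.
  have m0 : measurable_fun [set: X] (cst (0%R : R)) by [].
  exact: (measurable_fun_ltr mlam m0 measurableT (Y := [set true])).
have iA n : mu.-integrable [set: X] (EFin \o \1_(A n)).
  apply/integrableP; split; first exact/measurable_EFinP/measurable_indic.
  under eq_integral do rewrite /= ger0_norm//.
  rewrite integral_indic// setIT; apply: le_lt_trans (mF n).2.
  by have [mFn _] := mF n; apply: le_measure; rewrite ?inE// => x [].
pose pol n := polar_integral a lam omega (\1_(A n)).
pose npol n r := \int[omega r]_(x in sphere a r) (\1_(A n) x * - lam x)%:E.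
have npol0 n x : (0 <= \1_(A n) x * - lam x)%R.
  rewrite indicE; case: (boolP (x \in A n)); rewrite ?mul0r// inE => -[_ /=].
  by rewrite mul1r oppr_ge0; exact: ltW.
have polN n r : pol n r = - npol n r.
  rewrite -integral_ge0N; last by move=> x _; rewrite lee_fin npol0.
  by apply: eq_integral => x _; rewrite -EFinN mulrN opprK.
have npol_ge0 n r : 0 <= npol n r.
  by apply: integral_ge0 => x _; rewrite lee_fin npol0.
have npolE n r : npol n r = - pol n r by rewrite polN oppeK.
(* The part of [mu] on which the density is negative has nonnegative measure,
   whereas the decomposition gives it a nonpositive one. *)
have pol_ae0 n : {ae leb, forall r, `]0%R, +oo[%classic r -> pol n r = 0}.
  have [mpol Ipol] := polarE _ (iA n).
  apply/(ae_eq_integral_abs leb (measurable_itv _) mpol).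
  have -> : \int[leb]_(r in `]0%R, +oo[) `|pol n r| =
      \int[leb]_(r in `]0%R, +oo[) npol n r.
    by apply: eq_integral => r _; rewrite polN abseN gee0_abs.
  apply/eqP; rewrite eq_le integral_ge0// andbT -oppe_ge0 -integral_ge0N//.
  under eq_integral do rewrite -polN.
  by rewrite -Ipol; apply: integral_ge0 => x _; rewrite lee_fin.
(* [Good] collects the radii for which [lam] is nonnegative almost everywhere on
   the sphere; [kappa r] is defined to be zero for the others. *)
pose Good : set R :=
  \bigcap_n (`]0%R, +oo[%classic `&` pol n @^-1` [set 0]).
have mGood : measurable Good.
  apply: bigcapT_measurable => n; have [mpol _] := polarE _ (iA n).
  by apply: mpol => //; exact: measurable_itv.
have aeGood : {ae leb, forall r, (0 < r)%R -> Good r}.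
  have := ae_foralln pol_ae0; apply: filterS => r pol0 r0 n _.
  by split => /=; [rewrite in_itv/= r0|apply: pol0; rewrite /= in_itv/= r0].
have lam_ge0 r : Good r ->
    {ae omega r, forall x, sphere a r x -> (0 <= lam x)%R}.
  move=> Gr; have mS := measurable_sphere a r.
  have ae0 n : {ae omega r, forall x, sphere a r x ->
      (\1_(A n) x * - lam x)%:E = 0}.
    have mf : measurable_fun (sphere a r) (fun x => (\1_(A n) x * - lam x)%:E).
      apply: measurable_funTS; apply/measurable_EFinP.
      apply: measurable_funM; first exact: measurable_indic.
      exact: measurableT_comp.
    apply/(ae_eq_integral_abs (omega r) mS mf).
    under eq_integral do rewrite gee0_abs ?lee_fin//.
    by rewrite -/(npol n r) npolE; have [_ /= ->] := Gr n I; rewrite oppe0.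
  have := ae_foralln ae0; apply: filterS => x lam0 xr; rewrite leNgt.
  apply/negP => lamx; have [n _ Fnx] : (\bigcup_i F i) x by rewrite -FT.
  have := lam0 n xr; rewrite indicE mem_set// mul1r => -[] /eqP.
  by rewrite oppr_eq0 lt_eqF.
pose h (r : R) (x : X) : R :=
  (if r \in Good then Num.max (lam x) 0 * \1_(sphere a r) x else 0)%R.
have mh r : measurable_fun [set: X] (h r).
  rewrite /h; case: (r \in Good) => //; apply: measurable_funM.
    exact: measurable_maxr.
  exact/measurable_indic/measurable_sphere.
have h0 r x : (0 <= h r x)%R.
  by rewrite /h; case: (r \in Good) => //; rewrite mulr_ge0// le_max lexx orbT.
pose kappa r : {measure set X -> \bar R} := density (omega r) (mh r) (h0 r).
have kappaE r g : Good r -> measurable_fun [set: X] g ->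
    polar_integral a lam omega g r = \int[kappa r]_x (g x)%:E.
  move=> Gr mg; rewrite integral_density; last exact/measurable_EFinP.
  rewrite /polar_integral.
  transitivity (\int[omega r]_(x in sphere a r) (g x * Num.max (lam x) 0)%R%:E).
    apply: ae_eq_integral.
    - exact: measurable_sphere.
    - by apply: measurable_funTS; apply/measurable_EFinP/measurable_funM.
    - apply: measurable_funTS; apply/measurable_EFinP/measurable_funM => //.
      exact: measurable_maxr.
    by apply: filterS (lam_ge0 r Gr) => x /[apply] lam0; rewrite max_l.
  rewrite [LHS]integral_mkcond; apply: eq_integral => x _.
  rewrite /h mem_set// patchE indicE.
  by case: (x \in sphere a r); rewrite ?mulr1// !mulr0 mule0.
have kappa0 r : ~ Good r -> forall g : X -> \bar R, measurable_fun [set: X] g ->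
    \int[kappa r]_x g x = 0.
  move=> Gr g mg; rewrite integral_density// integral0_eq// => x _.
  by rewrite /h memNset// mule0.
have k1 (g : X -> R) : mu.-integrable [set: X] (EFin \o g) ->
    measurable_fun [set: R] (fun r => \int[kappa r]_x (g x)%:E) /\
    \int[mu]_x (g x)%:E = \int[leb]_r \int[kappa r]_x (g x)%:E.
  move=> ig; have [mpol Ipol] := polarE _ ig.
  have mg : measurable_fun [set: X] g.
    by apply/measurable_EFinP; exact: measurable_int ig.
  have kE : (fun r => \int[kappa r]_x (g x)%:E) =
      (polar_integral a lam omega g) \_ Good.
    apply/funext => r; rewrite patchE; case: ifPn.
      by rewrite inE => Gr; rewrite kappaE.
    by rewrite notin_setE => Gr; rewrite kappa0//; exact/measurable_EFinP.
  have sub : Good `<=` `]0%R, +oo[ by move=> r /(_ 0%N I)[].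
  have mpolG : measurable_fun Good (polar_integral a lam omega g).
    exact: measurable_funS mpol.
  split.
    rewrite kE; exact/(measurable_restrictT _ mGood).
  rewrite kE -integral_mkcond Ipol [RHS]integral_mkcond [LHS]integral_mkcond.
  apply: ae_eq_integral => //.
  - exact/(measurable_restrictT _ (measurable_itv _)).
  - exact/(measurable_restrictT _ mGood).
  apply: (@filterS _ _ (ae_filter_ringOfSetsType leb) _ _ _ aeGood) => r Gr _.
  rewrite !patchE.
  have [rG|rG] := boolP (r \in Good).
    by rewrite mem_set//; apply: sub; exact: set_mem.
  rewrite memNset// /= in_itv/= andbT => /Gr.
  by move: rG; rewrite notin_setE.
have k2 (g : X -> \bar R) : measurable_fun [set: X] g -> (forall x, 0 <= g x) ->
    measurable_fun [set: R] (fun r => \int[kappa r]_x g x) /\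
    \int[mu]_x g x = \int[leb]_r \int[kappa r]_x g x.
  move=> mg g0.
  have [g_ [ig g_0 ndg g_g]] := sigma_finite_integrable_approx sfmu mg g0.
  have mg_ n : measurable_fun [set: X] (EFin \o g_ n).
    exact: measurable_int (ig n).
  have nd_int (nu : {measure set X -> \bar R}) m n : (m <= n)%N ->
      \int[nu]_x (g_ m x)%:E <= \int[nu]_x (g_ n x)%:E.
    by move=> mn; apply: ae_le_integral; apply: aeW => x _; rewrite lee_fin ?ndg.
  have lim_int (nu : {measure set X -> \bar R}) :
      \int[nu]_x (g_ n x)%:E @[n --> \oo] --> \int[nu]_x g x.
    have -> : \int[nu]_x g x = \int[nu]_x limn (fun n => (g_ n x)%:E).
      by apply: eq_integral => x _; apply/esym/cvg_lim.
    apply: cvg_monotone_convergence => //.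
    - by move=> n x _; rewrite lee_fin.
    - by move=> x _ m n mn; rewrite lee_fin ndg.
  split.
    apply: (emeasurable_fun_cvg (fun n r => \int[kappa r]_x (g_ n x)%:E)).
      by move=> n; exact: (k1 _ (ig n)).1.
    by move=> r _; exact: lim_int.
  have -> : \int[mu]_x g x = limn (fun n => \int[mu]_x (g_ n x)%:E).
    by apply/esym/cvg_lim => //; exact: lim_int.
  under eq_fun do rewrite (k1 _ (ig _)).2.
  rewrite -monotone_convergence//.
  - by apply: eq_integral => r _; apply/cvg_lim => //; exact: lim_int.
  - by move=> n; exact: (k1 _ (ig n)).1.
  - by move=> n r _; apply: integral_ge0 => x _; rewrite lee_fin.
  - by move=> r _ m n; exact: nd_int.
exists kappa; split; last first.
  apply: (@filterS _ _ (ae_filter_ringOfSetsType leb) _ _ _ aeGood) => r Gr r0 g.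
  exact/kappaE/Gr.
split.
- by move=> g mg g0; have [] := k2 g mg g0.
- by move=> g mg g0; have [] := k2 g mg g0.
- move=> r; rewrite /kappa/= /density integral0_eq// => x /= xr.
  by rewrite /h; case: ifP => // _; rewrite indicE memNset// mulr0.
- move=> r r0; rewrite /kappa/= /density integral0_eq// => x _.
  rewrite /h memNset// => /(_ 0%N I)[] /=.
  by rewrite in_itv/= andbT ltNge r0.
Qed.

End disintegration.

(** * Integration of radial functions *)

Section disintegration_theory.
Context {d : measure_display} {R : realType} {X : borelMetricType d R}.
Variables (mu : {measure set X -> \bar R}) (a : X)
  (kappa : R -> {measure set X -> \bar R}).
Hypothesis disint : disintegrates mu a kappa.
Local Open Scope ereal_scope.
Local Notation leb := (@lebesgue_measure R).
Implicit Types (f g : X -> \bar R).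

Let aeS := @filterS _ _ (ae_filter_ringOfSetsType leb).

Lemma ae_disintegrates (P : X -> Prop) : {ae mu, forall x, P x} ->
  {ae leb, forall r, {ae kappa r, forall x, P x}}.
Proof.
move=> [N [mN N0 PN]]; have [mk muE _ _] := disint.
have mi : measurable_fun [set: X] (fun x => (\1_N x)%:E : \bar R).
  exact/measurable_EFinP/measurable_indic.
have i0 x : 0 <= (\1_N x)%:E :> \bar R by rewrite lee_fin.
have : {ae leb, forall r, \int[kappa r]_x (\1_N x)%:E = 0}.
  apply: integral_eq0_ae0; first exact: mk.
    by move=> r; exact: integral_ge0.
  by rewrite -muE// integral_indic// setIT.
apply: aeS => r; rewrite integral_indic// setIT => kN.
by exists N.
Qed.

Lemma integral_kappa_le0 g r : (r <= 0)%R -> \int[kappa r]_x g x = 0.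
Proof.
move=> r0; have [_ _ _ /(_ r r0) k0] := disint.
rewrite -(integral0 (kappa r) setT); apply: ae_ge0_eq_integral; first exact: aeW.
exact: measure0_ae.
Qed.

Lemma integral_kappa_radial (h : R -> \bar R) g r :
  (forall s, 0 <= h s) -> measurable_fun [set: X] g -> (forall x, 0 <= g x) ->
  \int[kappa r]_x (h (mdist a x) * g x) = h r * \int[kappa r]_x g x.
Proof.
move=> h0 mg g0; rewrite -ge0_integralZl//; apply: ae_ge0_eq_integral.
  by apply: aeW => x _; rewrite mule_ge0.
have [_ _ k0 _] := disint.
exists (~` sphere a r); split => //; first exact/measurableC/measurable_sphere.
by move=> x /= /not_implyP[_ hx] xr; apply: hx; rewrite xr.
Qed.

Lemma integral_disintegrates_radial (h : R -> \bar R) g :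
  measurable_fun [set: R] h -> (forall s, 0 <= h s) ->
  measurable_fun [set: X] g -> (forall x, 0 <= g x) ->
  \int[mu]_x (h (mdist a x) * g x) =
  \int[leb]_(r in `]0%R, +oo[) (h r * \int[kappa r]_x g x).
Proof.
move=> mh h0 mg g0; have [_ muE _ _] := disint.
rewrite muE; last 2 first.
- apply: emeasurable_funM => //.
  by apply: measurableT_comp => //; exact: measurable_mdist.
- by move=> x; rewrite mule_ge0.
rewrite [RHS]integral_mkcond; apply: eq_integral => r _.
rewrite integral_kappa_radial// patchE; case: ifPn => // /negP rn.
rewrite integral_kappa_le0 ?mule0// leNgt; apply/negP => r0; apply: rn.
by rewrite inE/= in_itv/= r0.
Qed.

Lemma integral_disintegrates g :
  measurable_fun [set: X] g -> (forall x, 0 <= g x) ->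
  \int[mu]_x g x = \int[leb]_(r in `]0%R, +oo[) \int[kappa r]_x g x.
Proof.
move=> mg g0; have := @integral_disintegrates_radial (cst 1) g.
move=> /(_ _ _ mg g0); under eq_integral do rewrite mul1e.
by under [X in _ -> _ -> _ = X]eq_integral do rewrite mul1e; apply.
Qed.

Lemma integral_ball_disintegrates g s :
  measurable_fun [set: X] g -> (forall x, 0 <= g x) ->
  \int[mu]_(x in ball a s) g x = \int[leb]_(r in `]0%R, s[) \int[kappa r]_x g x.
Proof.
move=> mg g0; rewrite integral_mkcond.
have ballE x : (x \in (ball a s : set X)) = (mdist a x \in `]-oo, s[%classic).
  by rewrite ballEmdist; apply/idP/idP; rewrite !inE/= ?in_itv.
transitivity (\int[mu]_x ((\1_(`]-oo, s[%classic) (mdist a x))%:E * g x)).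
  apply: eq_integral => x _; rewrite patchE indicE ballE.
  by case: ifP; rewrite ?mul1e ?mul0e.
rewrite (integral_disintegrates_radial
  (h := fun r => (\1_(`]-oo, s[%classic) r)%:E))//.
rewrite [LHS]integral_mkcond [RHS]integral_mkcond; apply: eq_integral => r _.
rewrite !patchE indicE.
have -> : (r \in `]0%R, s[%classic) =
    (r \in `]0%R, +oo[%classic) && (r \in `]-oo, s[%classic).
  apply/idP/andP => [|[]]; rewrite !inE/= !in_itv/= ?andbT.
    by move=> /andP[].
  by move=> -> ->.
case: (r \in `]0%R, +oo[%classic) => //=.
by case: ifP; rewrite ?mul1e ?mul0e.
by apply/measurable_EFinP/measurable_indic; exact: measurable_itv.
Qed.

End disintegration_theory.

(** * Measurability of primitives *)

Section radial_primitive.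
Context {R : realType}.
Local Open Scope ereal_scope.
Local Notation leb := (@lebesgue_measure R).

(** The primitive is a partial integral of a nonnegative measurable function of
    two variables. *)
Lemma measurable_integral_itv0 (g : R -> \bar R) :
  measurable_fun [set: R] g -> (forall r, 0 <= g r) ->
  measurable_fun [set: R] (fun s => \int[leb]_(r in `]0%R, s[) g r).
Proof.
move=> mg g0.
pose f (z : R * R) : \bar R :=
  if ((0 < z.2) && (z.2 < z.1))%R then g z.2 else 0.
have -> : (fun s => \int[leb]_(r in `]0%R, s[) g r) = fubini_F leb f.
  apply/funext => s; rewrite /fubini_F [LHS]integral_mkcond.
  by apply: eq_integral => r _; rewrite patchE /f /= mem_setE in_itv.
apply: measurable_fun_fubini_tonelli_F; last first.
  by move=> z; rewrite /f; case: ifP.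
apply: measurable_fun_ifT => //.
  apply: measurable_and; apply: measurable_fun_ltr => //.
exact: measurableT_comp.
Qed.

End radial_primitive.

(** * The weighted Hoelder inequality *)

Section weighted_hoelder.
Context {d : measure_display} {T : measurableType d} {R : realType}.
Variable nu : {measure set T -> \bar R}.
Local Open Scope ereal_scope.

Lemma conj_exponentE (p : R) : (1 < p)%R -> conj_exponent p = (p / (p - 1))%R.
Proof.
move=> p1; rewrite /conj_exponent /hoelder_conjugate/= eqe.
rewrite gt_eqF ?(lt_trans ltr01)// -EFinB inver subr_eq0 gt_eqF//.
Qed.

(** Hoelder's inequality for the splitting of [f] as the product of
    [f v^(1/p)] and [v^(-1/p)].  It also holds when the integral of [v^(1-p')] is
    zero, since then [f] vanishes almost everywhere, or infinite. *)
Lemma weighted_hoelder (p : R) (f v : T -> R) : (1 < p)%R ->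
  measurable_fun [set: T] f -> measurable_fun [set: T] v ->
  (forall x, (0 <= f x)%R) -> {ae nu, forall x, (0 < v x)%R} ->
  (\int[nu]_x (f x)%:E) `^ p *
    ((\int[nu]_x (v x `^ (1 - conj_exponent p))%:E) `^ (p - 1))^-1 <=
  \int[nu]_x (f x `^ p * v x)%:E.
Proof.
move=> p1 mf mv f0 v0; rewrite conj_exponentE//; set s := (p / (p - 1))%R.
have p0 : (0 < p)%R by exact: lt_trans p1.
have pB1 : (0 < p - 1)%R by rewrite subr_gt0.
have s0 : (0 < s)%R by rewrite divr_gt0.
have ps : (p^-1 + s^-1 = 1)%R by rewrite /s; field; rewrite !gt_eqF.
pose F x := (f x * v x `^ p^-1)%R; pose G x := (v x `^ (- p^-1))%R.
have mF : measurable_fun [set: T] F.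
  by apply: measurable_funM => //; exact: (measurableT_comp (measurable_powR _)).
have mG : measurable_fun [set: T] G.
  exact: (measurableT_comp (measurable_powR _)).
have If : 'N[nu]_1[EFin \o (F \* G)%R] = \int[nu]_x (f x)%:E.
  rewrite Lnorm1; apply: ae_ge0_eq_integral.
    by apply: aeW => x _; rewrite lee_fin.
  apply: filterS v0 => x vx _ /=; rewrite /F /G powRN mulfK ?ger0_norm//.
  by rewrite gt_eqF// powR_gt0.
have IF : 'N[nu]_p%:E[EFin \o F] `^ p = \int[nu]_x (f x `^ p * v x)%:E.
  rewrite poweR_Lnorm; last by rewrite gt_eqF.
  apply: ae_ge0_eq_integral.
    by apply: filterS v0 => x vx _; rewrite lee_fin mulr_ge0 ?powR_ge0// ltW.
  apply: filterS v0 => x vx _ /=; rewrite ger0_norm ?mulr_ge0 ?powR_ge0//.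
  by rewrite powRM ?powR_ge0// -powRrM mulVf ?gt_eqF// powRr1// ltW.
have IG : 'N[nu]_s%:E[EFin \o G] `^ s = \int[nu]_x (v x `^ (1 - s))%:E.
  rewrite poweR_Lnorm; last by rewrite gt_eqF.
  apply: eq_integral => x _ /=.
  rewrite ger0_norm ?powR_ge0// -powRrM; congr (_ `^ _)%:E.
  by rewrite /s; field; rewrite !gt_eqF.
set A := \int[nu]_x (f x `^ p * v x)%:E.
set W := \int[nu]_x (v x `^ (1 - s))%:E.
have A0 : 0 <= A by rewrite /A -IF poweR_ge0.
have W0 : 0 <= W by rewrite /W -IG poweR_ge0.
have fAW : (\int[nu]_x (f x)%:E) `^ p <= A * W `^ (p - 1).
  rewrite -If /A /W -IF -IG -poweRrM.
  have -> : (s * (p - 1) = p)%R by rewrite /s divfK// gt_eqF.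
  rewrite -poweRM ?Lnorm_ge0//; apply: gt0_ler_poweR; first exact: ltW.
  - by rewrite in_itv/= Lnorm_ge0 leey.
  - by rewrite in_itv/= mule_ge0 ?Lnorm_ge0 ?leey.
  - exact: hoelder.
have := poweR_ge0 W (p - 1); move: (W `^ (p - 1)) fAW => [w| |]// fAw w0.
- have [wE|wN0] := eqVneq w 0%R.
    move: fAw; rewrite wE mule0 => f_le0.
    have -> : (\int[nu]_x (f x)%:E) `^ p = 0.
      by apply/eqP; rewrite eq_le f_le0 poweR_ge0.
    by rewrite mul0e.
  by rewrite inver (negbTE wN0) lee_pdivrMr// lt0r wN0.
- by rewrite invey mule0.
Qed.

End weighted_hoelder.

(** * Transfer of the left-hand side and of the weights *)

Section polar_disintegration_theory.
Context {d : measure_display} {R : realType} {X : borelMetricType d R}.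
Variables (mu : {measure set X -> \bar R}) (a : X) (lam : X -> R)
  (omega kappa : R -> {measure set X -> \bar R}).
Local Open Scope ereal_scope.
Local Notation leb := (@lebesgue_measure R).
Hypothesis disint : disintegrates mu a kappa.
Hypothesis polarE : {ae leb, forall r, (0 < r)%R -> forall g : X -> R,
  measurable_fun [set: X] g ->
  polar_integral a lam omega g r = \int[kappa r]_x (g x)%:E}.

Let aeS := @filterS _ _ (ae_filter_ringOfSetsType leb).
Let aeS2 := @filterS2 _ _ (ae_filter_ringOfSetsType leb).

Let itvP0 (r : R) : `]0%R, +oo[%classic r = (0 < r)%R.
Proof. by rewrite /= in_itv/= andbT. Qed.

(** If [F1], [F2] are the spherical integrals of [f1], [f2], then the left-hand
    sides of the inequalities on [X] and on the half-line coincide. *)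
Lemma integral_H2B (q : R) (u f1 f2 : X -> R) (F1 F2 : R -> R) :
  measurable_fun [set: X] u -> {ae mu, forall x, (0 < u x)%R} ->
  measurable_fun [set: X] f1 -> measurable_fun [set: X] f2 ->
  (forall x, (0 <= f1 x)%R) -> (forall x, (0 <= f2 x)%R) ->
  {ae leb, forall r, (0 < r)%R -> (F1 r)%:E = \int[kappa r]_x (f1 x)%:E} ->
  {ae leb, forall r, (0 < r)%R -> (F2 r)%:E = \int[kappa r]_x (f2 x)%:E} ->
  \int[mu]_x (H2B mu a f1 f2 x `^ q * (u x)%:E) =
  \int[leb]_(t in `]0%R, +oo[) (H2 F1 F2 t `^ q * Utilde a lam omega u t).
Proof.
move=> mu_ u0 mf1 mf2 f10 f20 F1E F2E; have [mk _ _ _] := disint.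
pose P (f : X -> R) r := \int[kappa r]_x (f x)%:E.
have mP (f : X -> R) : measurable_fun [set: X] f -> (forall x, (0 <= f x)%R) ->
    measurable_fun [set: R] (P f).
  by move=> mf f0; apply: mk; [exact/measurable_EFinP|move=> x; rewrite lee_fin].
have P0 (f : X -> R) r : (forall x, (0 <= f x)%R) -> 0 <= P f r.
  by move=> f0; apply: integral_ge0 => x _; rewrite lee_fin.
pose I (f : X -> R) s := \int[leb]_(r in `]0%R, s[) P f r.
have I0 (f : X -> R) s : (forall x, (0 <= f x)%R) -> 0 <= I f s.
  by move=> f0; apply: integral_ge0 => r _; exact: P0.
have mI (f : X -> R) : measurable_fun [set: X] f -> (forall x, (0 <= f x)%R) ->
    measurable_fun [set: R] (I f).
  by move=> mf f0; apply: measurable_integral_itv0 => [|r]; [exact: mP|exact: P0].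
have IF (f : X -> R) (F : R -> R) t : (forall x, (0 <= f x)%R) ->
    {ae leb, forall r, (0 < r)%R -> (F r)%:E = P f r} ->
    \int[leb]_(r in `]0%R, t[) (F r)%:E = I f t.
  move=> f0 FE; apply: ae_ge0_eq_integral.
    by apply: aeW => r _; exact: P0.
  apply: aeS FE => r FE; rewrite /= in_itv/= => /andP[r0 _]; exact: FE.
pose Phi s := (I f1 s * I f2 s) `^ q.
have mPhi : measurable_fun [set: R] Phi.
  apply: (measurableT_comp (measurable_poweR _)).
  by apply: emeasurable_funM; exact: mI.
have Phi0 s : 0 <= Phi s by exact: poweR_ge0.
(* [u] may take negative values on a [mu]-null set. *)
pose u' x := Num.max (u x) 0%R.
have mu' : measurable_fun [set: X] (EFin \o u').
  by apply/measurable_EFinP; exact: measurable_maxr.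
have u'0 x : 0 <= (EFin \o u') x by rewrite lee_fin le_max lexx orbT.
transitivity (\int[mu]_x (Phi (mdist a x) * (EFin \o u') x)).
  apply: ae_ge0_eq_integral; first by apply: aeW => x _; rewrite mule_ge0.
  apply: filterS u0 => x ux _ /=; rewrite /u' max_l ?(ltW ux)//.
  congr (_ `^ _ * _); rewrite /H2B /I.
  by congr (_ * _); apply: (integral_ball_disintegrates disint) => //;
    exact/measurable_EFinP.
rewrite (integral_disintegrates_radial disint)//.
apply/esym/ae_ge0_eq_integral.
  by apply: aeW => r _; rewrite mule_ge0// integral_ge0.
have ku := ae_disintegrates disint u0.
apply: aeS2 polarE ku => r pr ur; rewrite itvP0 => r0.
rewrite /Phi -(IF _ _ r f10 F1E) -(IF _ _ r f20 F2E); congr (_ * _).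
rewrite /Utilde pr//; apply: ae_ge0_eq_integral; first exact: aeW.
by apply: filterS ur => x ux _; rewrite /= /u' max_l// ltW.
Qed.

Lemma Vtilde_ae (p : R) (v : X -> R) : measurable_fun [set: X] v ->
  {ae leb, forall r, (0 < r)%R -> Vtilde a lam omega p v r =
    ((\int[kappa r]_x (v x `^ (1 - conj_exponent p))%:E) `^ (p - 1))^-1}.
Proof.
move=> mv; apply: aeS polarE => r pr r0; rewrite /Vtilde pr//.
exact: (measurableT_comp (measurable_powR _)).
Qed.

Lemma integral_kappa_lty_ae (g : X -> R) : L1loc mu [set: X] g ->
  (forall x, (0 <= g x)%R) ->
  {ae leb, forall r, (0 < r)%R -> \int[kappa r]_x (g x)%:E < +oo}.
Proof.
move=> [mg ig] g0; have [mk _ _ _] := disint.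
have mEg : measurable_fun [set: X] (EFin \o g) by exact/measurable_EFinP.
have gn (n : nat) : {ae leb, forall r,
    `]0%R, n%:R[%classic r -> \int[kappa r]_x (g x)%:E < +oo}.
  apply: integral_lty_ae; first exact: measurable_itv.
  - by apply: measurable_funTS; apply: mk => // x; rewrite lee_fin.
  - by move=> r; apply: integral_ge0 => x _; rewrite lee_fin.
  rewrite -(integral_ball_disintegrates disint) => [||x]; rewrite ?lee_fin//.
  have /integrableP[_] : mu.-integrable (ball a (n%:R : R)) (EFin \o g).
    apply: ig; first exact: measurable_metric_ball.
      by exists a, n%:R.
    by exists 1%R.
  by under eq_integral do rewrite gee0_abs ?lee_fin//.
apply: aeS (ae_foralln gn) => r rn r0.
apply: (rn (Num.truncn r).+1); rewrite /= in_itv/= r0.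
exact: truncnS_gt.
Qed.

End polar_disintegration_theory.

(** * Sigma-finiteness *)

Section sigma_finiteness.
Context {d : measure_display} {R : realType} {X : borelMetricType d R}.
Local Open Scope ereal_scope.

(** The sets of the cover are the traces on balls of the superlevel sets of [g],
    enlarged by the null set outside which [g] is positive. *)
Lemma L1loc_sigma_finite (mu : {measure set X -> \bar R}) (a : X) (g : X -> R) :
  L1loc mu [set: X] g -> {ae mu, forall x, (0 < g x)%R} ->
  sigma_finite [set: X] mu.
Proof.
move=> [mg ig] [Z [mZ Z0 gZ]].
pose E n := Z `|` (ball a (n%:R : R) `&` [set x | n.+1%:R^-1%:E <= `|(g x)%:E|]).
have mE n :
    measurable (ball a (n%:R : R) `&` [set x | n.+1%:R^-1%:E <= `|(g x)%:E|]).
  apply: emeasurable_fun_c_infty; first exact: measurable_metric_ball.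
  apply: measurable_funTS; apply: measurableT_comp => //.
  exact/measurable_EFinP.
exists E.
  apply/esym; rewrite -subTset => x _; have [Zx|Zx] := pselect (Z x).
    by exists 0%N => //; left.
  have gx : (0 < g x)%R by apply: contrapT => gx; apply: Zx; exact: gZ.
  pose n := (Num.truncn (Num.max (mdist a x) (g x)^-1)%R).+1.
  have xn : (Num.max (mdist a x) (g x)^-1 < n%:R)%R by exact: truncnS_gt.
  exists n => //; right; split.
    by rewrite ballEmdist/=; move: xn; rewrite gt_max => /andP[].
  rewrite /= lee_fin ger0_norm ?(ltW gx)// invf_ple ?posrE//.
  rewrite (@le_trans _ _ n%:R)// ?ler_nat// ltW//.
  by move: xn; rewrite gt_max => /andP[].
move=> n; split; first exact: measurableU.
apply: (le_lt_trans (measureU2 _ mZ (mE n))).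
rewrite [X in X + _](_ : _ = 0) ?add0e; last exact: Z0.
have mb : measurable (ball a (n%:R : R)) by exact: measurable_metric_ball.
have /integrableP[mgb igb] : mu.-integrable (ball a (n%:R : R)) (EFin \o g).
  by apply: ig => //; [exists a, n%:R|exists 1%R].
have n0 : (0 < n.+1%:R^-1 :> R)%R by rewrite invr_gt0.
have := le_integral_abse mu mb mgb n0.
move=> /le_lt_trans => /(_ _ igb); rewrite muleC -lte_pdivlMr//.
by move=> /lt_le_trans; apply; rewrite leey.
Qed.

End sigma_finiteness.

(** * Transfer of the weighted norms *)

Section weight_transfer.
Context {d : measure_display} {R : realType} {X : borelMetricType d R}.
Variables (mu : {measure set X -> \bar R}) (a : X) (lam : X -> R)
  (omega kappa : R -> {measure set X -> \bar R}).
Local Open Scope ereal_scope.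
Local Notation leb := (@lebesgue_measure R).
Hypothesis disint : disintegrates mu a kappa.
Hypothesis polarE : {ae leb, forall r, (0 < r)%R -> forall g : X -> R,
  measurable_fun [set: X] g ->
  polar_integral a lam omega g r = \int[kappa r]_x (g x)%:E}.
Variables (p : R) (v : X -> R).
Hypotheses (p1 : (1 < p)%R) (mv : measurable_fun [set: X] v)
  (v_gt0 : {ae mu, forall x, (0 < v x)%R})
  (v_loc : L1loc mu [set: X] (fun x => v x `^ (1 - conj_exponent p))%R).

Let aeS := @filterS _ _ (ae_filter_ringOfSetsType leb).
Let aeS2 := @filterS2 _ _ (ae_filter_ringOfSetsType leb).
Let aeS3 := @filterS3 _ _ (ae_filter_ringOfSetsType leb).

Let itvP0 (r : R) : `]0%R, +oo[%classic r = (0 < r)%R.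
Proof. by rewrite /= in_itv/= andbT. Qed.

Let w (x : X) : R := (v x `^ (1 - conj_exponent p))%R.
(* Locking keeps unification from unfolding the integrals. *)
Let W : R -> \bar R := locked (fun r => \int[kappa r]_x (w x)%:E).

Let WE r : W r = \int[kappa r]_x (w x)%:E. Proof. by rewrite /W -lock. Qed.

Let p0 : (0 < p)%R. Proof. exact: lt_trans p1. Qed.

Let w0 x : (0 <= w x)%R. Proof. exact: powR_ge0. Qed.

Let mw : measurable_fun [set: X] w.
Proof. exact: (measurableT_comp (measurable_powR _)). Qed.

Let W0 r : 0 <= W r.
Proof. by rewrite WE; apply: integral_ge0 => x _; rewrite lee_fin. Qed.

Let mW : measurable_fun [set: R] W.
Proof.
rewrite (_ : W = fun r => \int[kappa r]_x (w x)%:E); last by apply/funext.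
have [mk _ _ _] := disint; apply: mk => [|x]; last by rewrite lee_fin.
exact/measurable_EFinP.
Qed.

Let V : R -> \bar R := locked (fun r => (W r `^ (p - 1))^-1).

Let VinveE r : V r = (W r `^ (p - 1))^-1. Proof. by rewrite /V -lock. Qed.

(* At [W r = +oo] the value [0 `^ (1 - p) = 0] is the right one because [fine]
   sends [+oo] to [0]. *)
Let VE r : V r = if 0 < W r then (fine (W r) `^ (1 - p))%:E else +oo.
Proof.
have pB1 : (p - 1 != 0)%R by rewrite gt_eqF// subr_gt0.
rewrite VinveE; have := W0 r; case: (W r) => [s| |]//.
- rewrite lee_fin lte_fin le_eqVlt => /predU1P[<-|s0].
    by rewrite ltxx poweR0r// inve0.
  rewrite s0 poweR_EFin inver gt_eqF ?powR_gt0//= -powRN opprB//.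
- by move=> _; rewrite lt0y poweRyr// invey /= powR0// -opprB oppr_eq0.
Qed.

Let mV : measurable_fun [set: R] V.
Proof.
rewrite (_ : V = fun r => if 0 < W r then (fine (W r) `^ (1 - p))%:E else +oo).
  apply: measurable_fun_ifT => //; first exact: measurable_fun_lte.
  apply/measurable_EFinP; apply: (measurableT_comp (measurable_powR _)).
  exact: measurableT_comp.
by apply/funext => r; exact: VE.
Qed.

Let V0 r : 0 <= V r.
Proof. by rewrite VE; case: ifP => // _; rewrite lee_fin powR_ge0. Qed.

Let W_lty : {ae leb, forall r, (0 < r)%R -> W r < +oo}.
Proof.
apply: aeS (integral_kappa_lty_ae disint v_loc w0) => r Wr r0.
by rewrite WE; exact: Wr.
Qed.

Let V_gt0 r : W r < +oo -> 0 < V r.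
Proof.
move=> Wr; rewrite VE; case: ifPn => // W_gt0; rewrite lte_fin powR_gt0//.
by rewrite fine_gt0// W_gt0.
Qed.

Let VtildeE : {ae leb, forall r, (0 < r)%R -> Vtilde a lam omega p v r = V r}.
Proof.
apply: aeS (Vtilde_ae polarE p mv) => r Vr r0.
by rewrite VinveE WE; exact: Vr.
Qed.

Let weighted_pos (f : X -> R) :
  \int[mu]_x (f x `^ p * v x)%:E = \int[mu]_x (f x `^ p * Num.max (v x) 0)%R%:E.
Proof.
apply: ae_ge0_eq_integral.
  by apply: aeW => x _; rewrite lee_fin mulr_ge0 ?powR_ge0// le_max lexx orbT.
by apply: filterS v_gt0 => x vx _; rewrite max_l// ltW.
Qed.

Let weighted_measurable (f : X -> R) : measurable_fun [set: X] f ->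
  measurable_fun [set: X] (fun x => (f x `^ p * Num.max (v x) 0)%R%:E).
Proof.
move=> mf; apply/measurable_EFinP; apply: measurable_funM.
  exact: (measurableT_comp (measurable_powR _)).
exact: measurable_maxr.
Qed.

Let weighted_ge0 (f : X -> R) x : 0 <= (f x `^ p * Num.max (v x) 0)%R%:E.
Proof. by rewrite lee_fin mulr_ge0 ?powR_ge0// le_max lexx orbT. Qed.

Lemma weighted_ge0_integral (f : X -> R) : 0 <= \int[mu]_x (f x `^ p * v x)%:E.
Proof. by rewrite weighted_pos; apply: integral_ge0 => x _. Qed.

Lemma weighted_eq0 (f : X -> R) : measurable_fun [set: X] f ->
  \int[mu]_x (f x `^ p * v x)%:E = 0 -> {ae mu, forall x, f x = 0%R}.
Proof.
move=> mf; rewrite weighted_pos => /integral_eq0_ae0.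
move=> /(_ (weighted_measurable mf) (weighted_ge0 f)) f0.
apply: filterS2 v_gt0 f0 => x vx [] /eqP.
rewrite mulf_eq0 max_l ?(ltW vx)// (gt_eqF vx) orbF powR_eq0.
by move=> /andP[/eqP].
Qed.

(** Spherical integration maps the weighted L^p space of [X] to that of the
    half-line, with norm at most one: this is Hoelder's inequality on spheres. *)
Lemma spherical_integral_bound (f : X -> R) :
  measurable_fun [set: X] f -> (forall x, (0 <= f x)%R) ->
  \int[mu]_x (f x `^ p * v x)%:E < +oo ->
  exists F : R -> R,
    [/\ measurable_fun [set: R] F, forall r, (0 <= F r)%R,
        {ae leb, forall r, (0 < r)%R -> (F r)%:E = \int[kappa r]_x (f x)%:E} &
        \int[leb]_(r in `]0%R, +oo[) ((F r `^ p)%:E * Vtilde a lam omega p v r)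
          <= \int[mu]_x (f x `^ p * v x)%:E].
Proof.
move=> mf f0; rewrite weighted_pos => fvoo; have [mk _ _ _] := disint.
have mPf : measurable_fun [set: R] (fun r => \int[kappa r]_x (f x)%:E).
  by apply: mk => [|x]; [exact/measurable_EFinP|rewrite lee_fin].
have Pf0 r : 0 <= \int[kappa r]_x (f x)%:E.
  by apply: integral_ge0 => x _; rewrite lee_fin.
pose Q r := \int[kappa r]_x (f x `^ p * Num.max (v x) 0)%R%:E.
have mQ : measurable_fun [set: R] Q.
  by apply: mk => //; exact: weighted_measurable.
have Q0 r : 0 <= Q r by exact: integral_ge0.
have IQ : \int[mu]_x (f x `^ p * Num.max (v x) 0)%R%:E =
    \int[leb]_(r in `]0%R, +oo[) Q r.
  apply: (integral_disintegrates disint) => //; exact: weighted_measurable.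
have Q_lty : {ae leb, forall r, `]0%R, +oo[%classic r -> Q r < +oo}.
  apply: integral_lty_ae => //; first exact: measurable_funTS.
  by rewrite -IQ.
have fQ : {ae leb, forall r, (\int[kappa r]_x (f x)%:E) `^ p * V r <= Q r}.
  apply: aeS (ae_disintegrates disint v_gt0) => r vr.
  rewrite VinveE WE; apply: le_trans (weighted_hoelder p1 mf mv f0 vr) _.
  rewrite le_eqVlt; apply/orP; left; apply/eqP; apply: ae_ge0_eq_integral.
    exact: aeW.
  by apply: filterS vr => x vx _; rewrite max_l// ltW.
have FE : {ae leb, forall r, (0 < r)%R ->
    (fine (\int[kappa r]_x (f x)%:E))%:E = \int[kappa r]_x (f x)%:E}.
  apply: aeS3 W_lty Q_lty fQ => r Wr Qr fQr r0.
  rewrite fineK// ge0_fin_numE// ltNge leye_eq; apply/eqP => fy.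
  move: fQr; rewrite fy poweRyr ?gt_eqF// gt0_mulye ?V_gt0 ?Wr//.
  by rewrite leNgt Qr// itvP0.
exists (fun r => fine (\int[kappa r]_x (f x)%:E)); split => //.
- exact: measurableT_comp.
- by move=> r; exact: fine_ge0.
rewrite IQ; apply: ae_le_integral.
  apply: aeS VtildeE => r Vr; rewrite itvP0 => r0; rewrite Vr//.
  by rewrite mule_ge0// lee_fin powR_ge0.
apply: aeS3 VtildeE FE fQ => r Vr Fr fQr; rewrite itvP0 => r0.
by rewrite Vr// -poweR_EFin Fr.
Qed.

Section converse.
Variable F : R -> R.
Hypothesis mF : measurable_fun `](0%R : R), +oo[ F.
Hypothesis F0 : forall t : R, (0 < t)%R -> (0 <= F t)%R.

Let F' : R -> R := locked (F \_ `](0%R : R), +oo[).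

Let F'patch : F' = F \_ `](0%R : R), +oo[. Proof. by rewrite /F' -lock. Qed.

Let mF' : measurable_fun [set: R] F'.
Proof. by rewrite F'patch; exact/(measurable_restrictT _ (measurable_itv _)). Qed.

Let F'E r : (0 < r)%R -> F' r = F r.
Proof. by move=> r0; rewrite F'patch patchE mem_set// itvP0. Qed.

Let F'0 r : (0 <= F' r)%R.
Proof.
rewrite F'patch patchE; case: ifPn => //; rewrite inE itvP0; exact: F0.
Qed.

Let halfline_weightedE :
  \int[leb]_(r in `]0%R, +oo[) ((F r `^ p)%:E * Vtilde a lam omega p v r) =
  \int[leb]_r ((F' r `^ p)%:E * V r).
Proof.
rewrite [RHS](_ : _ = \int[leb]_(r in `]0%R, +oo[) ((F' r `^ p)%:E * V r)).
  apply: ae_ge0_eq_integral.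
    by apply: aeW => r _; rewrite mule_ge0// lee_fin powR_ge0.
  by apply: aeS VtildeE => r Vr; rewrite itvP0 => r0; rewrite Vr// F'E.
rewrite [RHS]integral_mkcond; apply: eq_integral => r _.
rewrite patchE; case: ifPn => // rn; rewrite F'patch patchE (negbTE rn).
by rewrite powR0 ?mul0e// gt_eqF.
Qed.

Let mhalfline : measurable_fun [set: R] (fun r => (F' r `^ p)%:E * V r).
Proof.
apply: emeasurable_funM => //; apply/measurable_EFinP.
exact: (measurableT_comp (measurable_powR _)).
Qed.

Let halfline_ge0 r : 0 <= (F' r `^ p)%:E * V r.
Proof. by rewrite mule_ge0// lee_fin powR_ge0. Qed.

Lemma halfline_weighted_ge0_integral :
  0 <= \int[leb]_(r in `]0%R, +oo[) ((F r `^ p)%:E * Vtilde a lam omega p v r).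
Proof. by rewrite halfline_weightedE; exact: integral_ge0. Qed.

Lemma halfline_weighted_eq0 :
  \int[leb]_(r in `]0%R, +oo[) ((F r `^ p)%:E * Vtilde a lam omega p v r) = 0 ->
  {ae leb, forall r, (0 < r)%R -> F r = 0%R}.
Proof.
rewrite halfline_weightedE => FV0.
have F'V : {ae leb, forall r, (F' r `^ p)%:E * V r = 0}.
  exact: integral_eq0_ae0.
apply: aeS2 W_lty F'V => r Wr /eqP + r0.
rewrite mule_eq0 [V r == 0]gt_eqF ?V_gt0 ?Wr// orbF eqe powR_eq0 F'E//.
by move=> /andP[/eqP].
Qed.

(** Spreading [F] over the spheres proportionally to [v^(1-p')] attains equality
    in Hoelder's inequality on almost every sphere. *)
Lemma spherical_spread :
  \int[leb]_(r in `]0%R, +oo[) ((F r `^ p)%:E * Vtilde a lam omega p v r) < +oo ->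
  exists f : X -> R,
    [/\ measurable_fun [set: X] f, forall x, (0 <= f x)%R,
        {ae leb, forall r, (0 < r)%R -> (F r)%:E = \int[kappa r]_x (f x)%:E} &
        \int[mu]_x (f x `^ p * v x)%:E <=
        \int[leb]_(r in `]0%R, +oo[) ((F r `^ p)%:E * Vtilde a lam omega p v r)].
Proof.
rewrite halfline_weightedE => F_lty.
have FV_lty : {ae leb, forall r, [set: R] r -> (F' r `^ p)%:E * V r < +oo}.
  exact: integral_lty_ae.
have FW0 : {ae leb, forall r, W r = 0 -> F' r = 0%R}.
  apply: aeS FV_lty => r FVr Wr; apply/eqP; apply: contraTT (FVr I) => Fr.
  rewrite VE Wr ltxx gt0_muley ?ltxx// lte_fin powR_gt0//.
  by rewrite lt0r Fr F'0.
(* Where [W r] is [0] or [+oo], [fine (W r)] is [0] and so is [c r]. *)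
pose c r := (F' r * fine (W r) `^ (- 1))%R.
have c0 r : (0 <= c r)%R by rewrite mulr_ge0// powR_ge0.
have mc : measurable_fun [set: R] c.
  apply: measurable_funM => //; apply: (measurableT_comp (measurable_powR _)).
  exact: measurableT_comp.
have mEw : measurable_fun [set: X] (fun x => (w x)%:E) by exact/measurable_EFinP.
exists (fun x => c (mdist a x) * w x)%R; split.
- apply: measurable_funM => //.
  by apply: measurableT_comp => //; exact: measurable_mdist.
- by move=> x; rewrite mulr_ge0.
- apply: aeS2 W_lty FW0 => r Wr FWr r0.
  under eq_integral do rewrite EFinM.
  rewrite (integral_kappa_radial disint (h := fun s => (c s)%:E))//.
  rewrite -WE -F'E// /c; have := W0 r.
  move: (Wr r0) FWr; case: (W r) => [s _ FWr s0| |]//=.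
  rewrite -EFinM -mulrA powR_inv1//; have [s0'|sN0] := eqVneq s 0%R.
    by rewrite FWr ?s0'// mul0r.
  by rewrite mulVf// mulr1.
have -> : \int[mu]_x ((c (mdist a x) * w x) `^ p * v x)%:E =
    \int[mu]_x ((c (mdist a x) `^ p)%:E * (w x)%:E).
  apply: ae_ge0_eq_integral.
    by apply: aeW => x _; rewrite mule_ge0// lee_fin powR_ge0.
  apply: filterS v_gt0 => x vx _; rewrite -EFinM powRM// -mulrA; congr (_ * _)%:E.
  (* (1 - p') p + 1 = 1 - p' *)
  rewrite /w -powRrM -[X in (_ * X)%R](powRr1 (ltW vx)) -powRD.
    rewrite conj_exponentE//; congr (_ `^ _)%R; field.
    by rewrite gt_eqF// subr_gt0.
  by rewrite (gt_eqF vx) implybT.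
rewrite (integral_disintegrates_radial disint
  (h := fun s => (c s `^ p)%:E))//; last first.
- by move=> s; rewrite lee_fin powR_ge0.
- by apply/measurable_EFinP; apply: (measurableT_comp (measurable_powR _)).
rewrite integral_mkcond; apply: ae_le_integral.
  apply: aeW => r _; rewrite patchE; case: ifP => // _.
  by rewrite -WE mule_ge0 ?W0// lee_fin powR_ge0.
apply: aeS2 W_lty FW0 => r Wr FWr _; rewrite patchE; case: ifPn => //.
rewrite inE itvP0 => r0; rewrite -WE VE /c; have := W0 r.
move: (Wr r0) FWr; case: (W r) => [s _ FWr s0| |]//=.
have [sE|sN0] := eqVneq s 0%R.
  by rewrite FWr ?sE// mul0r powR0 ?gt_eqF// !mul0e.
have s_gt0 : (0 < s)%R by rewrite lt0r sN0.
rewrite lte_fin s_gt0 powRM ?powR_ge0// -!EFinM lee_fin -mulrA.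
rewrite ler_wpM2l ?powR_ge0//.
rewrite -powRrM -[X in (_ * X <= _)%R](powRr1 s0) -powRD; last by rewrite sN0 implybT.
by rewrite mulN1r addrC.
Qed.

End converse.

End weight_transfer.

(** * Products of two norms *)

Section norm_products.
Context {R : realType}.
Local Open Scope ereal_scope.
Variables (C p1 p2 : R).
Hypotheses (C0 : (0 < C)%R) (p1_gt0 : (0 < p1)%R) (p2_gt0 : (0 < p2)%R).

Lemma le_norm_product (A1 A2 B1 B2 : \bar R) : 0 <= A1 -> 0 <= A2 ->
  A1 <= B1 -> A2 <= B2 ->
  C%:E * A1 `^ p1^-1 * A2 `^ p2^-1 <= C%:E * B1 `^ p1^-1 * B2 `^ p2^-1.
Proof.
move=> A10 A20 AB1 AB2.
have pow_le (A B : \bar R) p : (0 < p)%R -> 0 <= A -> A <= B -> A `^ p^-1 <= B `^ p^-1.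
  move=> p0 A0 AB; apply: gt0_ler_poweR => //; first by rewrite invr_ge0 ltW.
    by rewrite in_itv/= A0 leey.
  by rewrite in_itv/= (le_trans A0 AB) leey.
have C0' : 0 <= C%:E by rewrite lee_fin ltW.
apply: lee_pmul; rewrite ?mule_ge0 ?poweR_ge0//; last exact: pow_le.
by apply: lee_pmul; rewrite ?poweR_ge0//; exact: pow_le.
Qed.

(** A bound by a product of two norms is trivial when one of them is infinite,
    unless the other one vanishes. *)
Lemma norm_product_bound (L A1 A2 : \bar R) : 0 <= A1 -> 0 <= A2 ->
  (A1 = 0 -> L = 0) -> (A2 = 0 -> L = 0) ->
  (A1 < +oo -> A2 < +oo -> L <= C%:E * A1 `^ p1^-1 * A2 `^ p2^-1) ->
  L <= C%:E * A1 `^ p1^-1 * A2 `^ p2^-1.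
Proof.
move=> A10 A20 L1 L2 LA; have C0' : 0 < C%:E by rewrite lte_fin.
have rhs0 : 0 <= C%:E * A1 `^ p1^-1 * A2 `^ p2^-1.
  by rewrite !mule_ge0 ?poweR_ge0// ltW.
have [A1E|A1N] := eqVneq A1 0; first by rewrite (L1 A1E).
have [A2E|A2N] := eqVneq A2 0; first by rewrite (L2 A2E).
have A1_gt0 : 0 < A1 by rewrite lt0e A1N.
have A2_gt0 : 0 < A2 by rewrite lt0e A2N.
have pN0 p : (0 < p)%R -> (p^-1 != 0)%R by move=> p0; rewrite gt_eqF// invr_gt0.
have [A1y|A1y] := eqVneq A1 +oo.
  by rewrite A1y poweRyr ?pN0// gt0_muley// gt0_mulye ?leey// poweR_gt0.
have [A2y|A2y] := eqVneq A2 +oo.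
  by rewrite A2y poweRyr ?pN0// gt0_muley ?leey// mule_gt0// poweR_gt0.
by apply: LA; rewrite ltey.
Qed.

End norm_products.

(** * Equivalence of the two Hardy inequalities *)

Theorem theorem1p1 (d : measure_display) (R : realType)
    (X : borelMetricType d R) (mu : {measure set X -> \bar R}) (a : X)
    (lam : X -> R) (omega : R -> {measure set X -> \bar R})
    (p1 p2 q : R) (u v1 v2 : X -> R)
    (Hp1 : 1 < p1) (Hp2 : 1 < p2) (Hq : 0 < q)
    (Hpolar : polar_decomposition mu a lam omega)
    (mu_u : measurable_fun [set: X] u)
    (mu_v1 : measurable_fun [set: X] v1)
    (mu_v2 : measurable_fun [set: X] v2)
    (u_gt0 : {ae mu, forall x, 0 < u x})
    (v1_gt0 : {ae mu, forall x, 0 < v1 x})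
    (v2_gt0 : {ae mu, forall x, 0 < v2 x})
    (u_loc : L1loc mu (~` [set a]) u)
    (v1_loc : L1loc mu [set: X] (fun x => v1 x `^ (1 - conj_exponent p1)))
    (v2_loc : L1loc mu [set: X] (fun x => v2 x `^ (1 - conj_exponent p2))) :
  forall C : R, 0 < C ->
    ((forall f1 f2 : X -> R,
        measurable_fun [set: X] f1 -> measurable_fun [set: X] f2 ->
        (forall x, 0 <= f1 x) -> (forall x, 0 <= f2 x) ->
        ((\int[mu]_x (H2B mu a f1 f2 x `^ q * (u x)%:E)) `^ q^-1 <=
         C%:E * (\int[mu]_x (f1 x `^ p1 * v1 x)%:E) `^ p1^-1 *
                (\int[mu]_x (f2 x `^ p2 * v2 x)%:E) `^ p2^-1)%E)
     <->
     (forall F1 F2 : R -> R,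
        measurable_fun `](0 : R), +oo[ F1 -> measurable_fun `](0 : R), +oo[ F2 ->
        (forall t : R, 0 < t -> 0 <= F1 t) -> (forall t : R, 0 < t -> 0 <= F2 t) ->
        ((\int[lebesgue_measure]_(t in `](0 : R)%R, +oo[)
            (H2 F1 F2 t `^ q * Utilde a lam omega u t)) `^ q^-1 <=
         C%:E *
         (\int[lebesgue_measure]_(t in `](0 : R)%R, +oo[)
            ((F1 t `^ p1)%:E * Vtilde a lam omega p1 v1 t)) `^ p1^-1 *
         (\int[lebesgue_measure]_(t in `](0 : R)%R, +oo[)
            ((F2 t `^ p2)%:E * Vtilde a lam omega p2 v2 t)) `^ p2^-1)%E)).
Proof.
move=> C C0.
have p1_gt0 : 0 < p1 by exact: lt_trans Hp1.
have p2_gt0 : 0 < p2 by exact: lt_trans Hp2.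
have qN0 : q^-1 != 0 by rewrite gt_eqF// invr_gt0.
have w1_gt0 : {ae mu, forall x, 0 < v1 x `^ (1 - conj_exponent p1)}.
  by apply: filterS v1_gt0 => x; exact: powR_gt0.
have sf_mu : sigma_finite [set: X] mu by exact: (L1loc_sigma_finite a v1_loc w1_gt0).
have [kappa [disint polarE]] := polar_disintegration Hpolar sf_mu.
have zero_ball (f : X -> R) r : {ae mu, forall x, f x = 0} ->
    (\int[mu]_(y in ball a r) (f y)%:E = 0)%E.
  move=> f0; rewrite -(integral0 mu (ball a r)); apply: ae_ge0_eq_integral.
    exact: aeW.
  by apply: filterS f0 => x -> _.
have zero_itv (F : R -> R) t :
    {ae @lebesgue_measure R, forall r, 0 < r -> F r = 0} ->
    (\int[lebesgue_measure]_(r in `](0 : R)%R, t[) (F r)%:E = 0)%E.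
  move=> F0; rewrite -(integral0 lebesgue_measure `](0 : R)%R, t[).
  apply: ae_ge0_eq_integral; first exact: aeW.
  apply: (@filterS _ _ (ae_filter_ringOfSetsType _) _ _ _ F0) => r Fr.
  by rewrite /= in_itv/= => /andP[/Fr -> _].
split=> [hardyX F1 F2 mF1 mF2 F10 F20|hardyR f1 f2 mf1 mf2 f10 f20].
- apply: norm_product_bound => //.
  + exact: (halfline_weighted_ge0_integral polarE Hp1 mu_v1 F1).
  + exact: (halfline_weighted_ge0_integral polarE Hp2 mu_v2 F2).
  + move=> /(halfline_weighted_eq0 disint polarE Hp1 mu_v1 v1_loc mF1) F1E.
    rewrite integral0_eq ?poweR0r// => t _.
    by rewrite /H2 zero_itv// mul0e poweR0r ?mul0e// gt_eqF.
  + move=> /(halfline_weighted_eq0 disint polarE Hp2 mu_v2 v2_loc mF2) F2E.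
    rewrite integral0_eq ?poweR0r// => t _.
    by rewrite /H2 (zero_itv F2)// mule0 poweR0r ?mul0e// gt_eqF.
  + move=> /(spherical_spread disint polarE Hp1 mu_v1 v1_gt0 v1_loc mF1 F10).
    move=> [f1 [mf1 f10 F1E f1F1]].
    move=> /(spherical_spread disint polarE Hp2 mu_v2 v2_gt0 v2_loc mF2 F20).
    move=> [f2 [mf2 f20 F2E f2F2]].
    rewrite -(integral_H2B disint polarE q mu_u u_gt0 mf1 mf2 f10 f20 F1E F2E).
    apply: le_trans (hardyX _ _ mf1 mf2 f10 f20) _.
    apply: (le_norm_product C0 p1_gt0 p2_gt0 _ _ f1F1 f2F2);
      exact: weighted_ge0_integral.
- apply: norm_product_bound => //.
  + exact: weighted_ge0_integral.
  + exact: weighted_ge0_integral.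
  + move=> /(weighted_eq0 mu_v1 v1_gt0 mf1) f1E.
    rewrite integral0_eq ?poweR0r// => x _.
    by rewrite /H2B zero_ball// mul0e poweR0r ?mul0e// gt_eqF.
  + move=> /(weighted_eq0 mu_v2 v2_gt0 mf2) f2E.
    rewrite integral0_eq ?poweR0r// => x _.
    by rewrite /H2B (zero_ball f2)// mule0 poweR0r ?mul0e// gt_eqF.
  + move=> /(spherical_integral_bound disint polarE Hp1 mu_v1 v1_gt0 v1_loc mf1 f10).
    move=> [F1 [mF1 F10 F1E F1f1]].
    move=> /(spherical_integral_bound disint polarE Hp2 mu_v2 v2_gt0 v2_loc mf2 f20).
    move=> [F2 [mF2 F20 F2E F2f2]].
    rewrite (integral_H2B disint polarE q mu_u u_gt0 mf1 mf2 f10 f20 F1E F2E).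
    have mF1' : measurable_fun `](0 : R), +oo[ F1 by exact: measurable_funTS.
    have mF2' : measurable_fun `](0 : R), +oo[ F2 by exact: measurable_funTS.
    apply: le_trans (hardyR _ _ mF1' mF2' (fun t _ => F10 t) (fun t _ => F20 t)) _.
    apply: (le_norm_product C0 p1_gt0 p2_gt0 _ _ F1f1 F2f2).
      exact: (halfline_weighted_ge0_integral polarE Hp1 mu_v1 F1).
    exact: (halfline_weighted_ge0_integral polarE Hp2 mu_v2 F2).
Qed.
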